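(* Consider the Gamma family such that $\{z_i\}_{i=1}^m$ are independent with parameters $\{(\theta_i,\sigma)\}_{i=1}^m$ and a fixed $\sigma>0$. Assume $t$ is positive and sufficiently large and set $u_{3,m}=\min_{1\le i\le m}\{1-\theta_i\}$. Then $$\mathbb V\{\hat\varphi_m(t,\mathbf z)-\varphi_m(t,\boldsymbol\theta)\}\le V_{\mathrm{III}}=\frac C{m^2}\exp\left(\frac{4t}{u_{3,m}}\right)\sum_{i=1}^m\left(\frac t{1-\theta_i}\right)^{3/4-\sigma}$$ and $$\Pr\{|\hat\varphi_m(t,\mathbf z)-\varphi_m(t,\boldsymbol\theta)|\ge\lambda\}\le\lambda^{-2}V_{\mathrm{III}} .$$
   Context: The Gamma family with parameters $(\theta,\sigma)$, $\theta<1$, $\sigma>0$, has distributions $G_\theta$ with density $f_\theta(x)=(1-\theta)^\sigma\frac{e^{\theta x}x^{\sigma-1}e^{-x}}{\Gamma(\sigma)}1_{(0,\infty)}(x)$. $z_i$ has distribution $G_{\theta_i}$; $\theta_0<1$ is fixed; $\mathbf z=(z_1,\dots,z_m)$, $\boldsymbol\theta=(\theta_1,\dots,\theta_m)$; $\lambda>0$ is arbitrary; $\mathbb V$ denotes variance. $\omega:[-1,1]\to\mathbb{R}$ is admissible (non-negative, bounded, $\int_{[-1,1]}\omega=1$), and $$K(t,x;\theta_0)=\int_{[-1,1]}\omega(s)\sum_{n=0}^\infty\frac{(-tsx)^n\,\Gamma(\sigma)\cos\left(\frac\pi2n+\frac{ts}{1-\theta_0}\right)}{n!\,\Gamma(\sigma+n)}ds,\qquad\psi(t,\theta;\theta_0)=\int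 K(t,x;\theta_0)dG_\theta(x),$$ $$\hat\varphi_m(t,\mathbf z)=\frac1m\sum_{i=1}^m\{1-K(t,z_i;\theta_0)\},\qquad\varphi_m(t,\boldsymbol\theta)=\frac1m\sum_{i=1}^m\{1-\psi(t,\theta_i;\theta_0)\}.$$ $C$ denotes a generic positive constant (not depending on $m$, $t$, $\lambda$). *)

(* Defs.v *)
From HB Require Import structures.
From mathcomp Require Import all_boot all_order all_algebra.
From mathcomp Require Import all_classical all_reals all_analysis.
From mathcomp Require Import measurable_realfun.

Set Implicit Arguments.
Unset Strict Implicit.
Unset Printing Implicit Defensive.

Import Order.TTheory GRing.Theory Num.Theory.
Import numFieldNormedType.Exports.

Local Open Scope classical_set_scope.
Local Open Scope ring_scope.

Section gamma_family.
Context {R : realType}.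
Notation mu := (@lebesgue_measure R).

Definition Gamma (a : R) : R :=
  \int[mu]_(x in `]0, +oo[) (x `^ (a - 1) * expR (- x)).

Definition gamma_pdf (sigma theta x : R) : R :=
  (1 - theta) `^ sigma *
  (expR (theta * x) * x `^ (sigma - 1) * expR (- x) / Gamma sigma) *
  \1_(`]0, +oo[ : set R) x.

Lemma Gamma_ge0 (a : R) : 0 <= Gamma a.
Proof.
by apply: Rintegral_ge0 => x _; rewrite mulr_ge0 ?powR_ge0 ?expR_ge0.
Qed.

Lemma gamma_pdf_ge0 (sigma theta x : R) : 0 <= gamma_pdf sigma theta x.
Proof.
by rewrite /gamma_pdf !mulr_ge0 ?powR_ge0 ?expR_ge0 ?invr_ge0 ?Gamma_ge0.
Qed.

Lemma measurable_gamma_pdf (sigma theta : R) :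
  measurable_fun setT (gamma_pdf sigma theta).
Proof.
apply: measurable_funM; last exact: measurable_indic.
apply: measurable_funM => //; apply: measurable_funM => //.
apply: measurable_funM.
  apply: measurable_funM; last exact: measurable_powR.
  by apply: measurableT_comp => //; exact: measurable_funM.
by apply: measurableT_comp => //; exact: measurableT_comp.
Qed.

(* For [sigma > 0] and [theta < 1] this is a probability; the measure axioms
   proved below hold for all values of the parameters. *)
Definition gamma_prob (sigma theta : R) (A : set (measurableTypeR R)) : \bar R :=
  (\int[mu]_(x in A) (gamma_pdf sigma theta x)%:E)%E.

End gamma_family.

Section gamma_measure.
Context {R : realType}.
Notation mu := (@lebesgue_measure R).
Variables sigma theta : R.

Let gamma_set0 : gamma_prob sigma theta set0 = 0%E.
Proof. by rewrite /gamma_prob integral_set0. Qed.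

Let gamma_ge0 A : (0 <= gamma_prob sigma theta A)%E.
Proof. by apply: integral_ge0 => x _; rewrite lee_fin gamma_pdf_ge0. Qed.

Let gamma_sigma_additive : semi_sigma_additive (gamma_prob sigma theta).
Proof.
move=> /= F mF tF mUF; rewrite /gamma_prob; apply: cvg_toP.
  apply: ereal_nondecreasing_is_cvgn => m n mn.
  apply: lee_sum_nneg_natr => // k _ _; apply: integral_ge0 => /= x Fkx.
  by rewrite lee_fin gamma_pdf_ge0.
rewrite ge0_integral_bigcup//=.
- apply/measurable_funTS/measurableT_comp => //.
  exact: measurable_gamma_pdf.
- by move=> x _; rewrite lee_fin gamma_pdf_ge0.
Qed.

HB.instance Definition _ := isMeasure.Build _ _ _
  (gamma_prob sigma theta) gamma_set0 gamma_ge0 gamma_sigma_additive.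

End gamma_measure.

Section null_proportion_estimator.
Context {R : realType}.
Notation mu := (@lebesgue_measure R).

(* Only the values of [omega] on [[-1, 1]] matter. *)
Definition admissible (omega : R -> R) : Prop :=
  [/\ measurable_fun (`[-1, 1] : set R) omega,
      forall s, -1 <= s <= 1 -> 0 <= omega s,
      exists M : R, forall s, -1 <= s <= 1 -> omega s <= M &
      \int[mu]_(s in `[-1, 1]) omega s = 1].

Definition K (sigma theta0 : R) (omega : R -> R) (t x : R) : R :=
  \int[mu]_(s in `[-1, 1]) (omega s *
    limn (series (fun n : nat =>
      (- t * s * x) ^+ n * Gamma sigma *
      cos (pi / 2 * n%:R + t * s / (1 - theta0)) /
      (n`!%:R * Gamma (sigma + n%:R))))).

Definition psi (sigma theta0 : R) (omega : R -> R) (t theta : R) : R :=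
  \int[gamma_prob sigma theta]_x K sigma theta0 omega t x.

Definition phi_hat (sigma theta0 : R) (omega : R -> R) (m : nat) (t : R)
    (z : 'I_m -> R) : R :=
  m%:R^-1 * \sum_(i < m) (1 - K sigma theta0 omega t (z i)).

Definition phi (sigma theta0 : R) (omega : R -> R) (m : nat) (t : R)
    (theta : 'I_m -> R) : R :=
  m%:R^-1 * \sum_(i < m) (1 - psi sigma theta0 omega t (theta i)).

Definition u3 (n : nat) (theta : 'I_n.+1 -> R) : R :=
  \big[Num.min/1 - theta ord0]_(i < n.+1) (1 - theta i).

Definition V_III (C sigma : R) (n : nat) (t : R) (theta : 'I_n.+1 -> R) : R :=
  C / n.+1%:R ^+ 2 * expR (4 * t / u3 theta) *
  \sum_(i < n.+1) (t / (1 - theta i)) `^ (3 / 4 - sigma).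

End null_proportion_estimator.

Definition mutually_independent (d : measure_display) (T : measurableType d) (R : realType)
    (P : probability T R) (I : finType) (X : I -> {RV P >-> R}) : Prop :=
  forall (J : {set I}) (B : I -> set R),
    (forall i, i \in J -> measurable (B i)) ->
    P (\bigcap_(i in [set` J]) X i @^-1` B i) =
    (\prod_(i in J) P (X i @^-1` B i))%E.

(* Main.v *)
Require Import Defs.
From HB Require Import structures.
From mathcomp Require Import all_boot all_order all_algebra.
From mathcomp Require Import all_classical all_reals all_analysis.
From mathcomp Require Import measurable_realfun ring lra zify.

(** The whole statement rests on a bound for one observation. Let z have the
Gamma law with parameters (theta, sigma) and let tau = t / (1 - theta). Then
some constant c_0, the same for all theta, satisfies
  E (K(t, z) - c_0)^2 <= C exp(4 tau) tau^(3/4 - sigma),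
with C independent of t and theta ([kernel_second_moment_le]). Independence makes
the covariances of the summands vanish, so the variance of the average is m^-2
times the sum of the variances, each of which is at most the mean square
distance to c_0; moreover tau_i <= t / u3 in the exponential. The error has
mean zero, so Chebyshev's inequality gives the deviation bound.

To bound one observation, the defining series is integrated in s term by term:
K(t, x) = sum_n c_n x^n with |c_n| <= t^n Gamma(sigma) / (n! Gamma(sigma + n))
([K_power_series]). The majorant is a modified Bessel function of r = 2 sqrt(tx)
up to a power factor, and only its growth matters ([kernel_series_bound]):
  sum_(n >= 1) v^n Gamma(sigma) / (n! Gamma(sigma + n))
    <= A v^(1/4 - sigma/2) exp(2 sqrt v).
Indeed n! Gamma(sigma + n) is at least of order 4^-n (2n)! n^(sigma - 1/2), so
the n-th term is at most of order n^(1/2 - sigma) r^(2n) / (2n)!, and a power of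
r / n in front of r^(2n) / (2n)! is absorbed by shifting the index in the
exponential series.

The exponent 1/4 - sigma/2 is the one for which the square of this majorant, at
v = b x, times the Gamma density is a multiple of x^(-1/2) exp(4 sqrt(b x) - a x)
with a = 1 - theta. Completing the square produces exp(4 b / a) and a Gaussian
factor exp(-u^2) with u = sqrt(a x) - 2 sqrt(b / a); since
exp(-u^2) <= 1 / (1 + u^2), what is left is bounded by a derivative of an
arctangent ([majorant_moment_le]).

The constant term c_0 is removed because tau^(3/4 - sigma) may tend to 0 with
tau. All other terms contain t at least once, so K(t, x) - c_0 is at most t / b
times the majorant at b x for every b >= t ([K_dist_le]). The choice
b = max(t, 1 - theta) gives the order tau^(1/2 - sigma) exp(4 tau) when
tau >= 1 and the order tau^2 when tau <= 1, and both are dominated by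
tau^(3/4 - sigma) exp(4 tau). *)

Set Implicit Arguments.
Unset Strict Implicit.
Unset Printing Implicit Defensive.

Import Order.TTheory GRing.Theory Num.Theory.
Import numFieldNormedType.Exports.

Local Open Scope classical_set_scope.
Local Open Scope ring_scope.

(** * Integrals over the half-line *)

Section half_line.
Context {R : realType}.
Notation mu := (@lebesgue_measure R).

Lemma continuous_measurable_pos (f : R -> R) :
  (forall x : R, 0 < x -> {for x, continuous f}) -> measurable_fun (`]0, +oo[ : set R) f.
Proof.
move=> cf; apply: open_continuous_measurable_fun; first exact: interval_open.
by move=> x; rewrite inE/= in_itv/= andbT; exact: cf.
Qed.

(** The integrand may blow up at 0, so the fundamental theorem of calculus is
applied on [1/(n+1), +oo[ and followed by monotone convergence. *)
Lemma ge0_integral_FTC_pos (f F : R -> R) (l0 l : R) :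
  (forall x, 0 < x -> 0 <= f x) ->
  (forall x : R, 0 < x -> {for x, continuous f}) ->
  (forall x : R, 0 < x -> is_derive x 1 F (f x)) ->
  F x @[x --> 0^'+] --> l0 -> F x @[x --> +oo%R] --> l ->
  (\int[mu]_(x in `]0%R, +oo[) (f x)%:E = (l - l0)%:E)%E.
Proof.
move=> f0 cf dF Fl0 Fl.
pose a (n : nat) : R := n.+1%:R^-1.
have a0 n : 0 < a n by rewrite /a invr_gt0 ltr0n.
have mf : measurable_fun (`]0, +oo[ : set R) (EFin \o f).
  by apply/measurable_EFinP; exact: continuous_measurable_pos.
have aU : \bigcup_n `[a n, +oo[%classic = `]0, +oo[%classic :> set R.
  apply/seteqP; split => x.
    by move=> [n _] /=; rewrite !in_itv/= !andbT; apply: lt_le_trans.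
  rewrite /= in_itv/= andbT => x0.
  have [n _ hn] : \forall n \near \oo, a n < x.
    have := @cvg_harmonic R; move/cvgrPdist_lt => /(_ _ x0).
    apply: filterS => n /=; rewrite sub0r normrN.
    by rewrite ger0_norm.
  exists n => //=; rewrite in_itv/= andbT; apply/ltW/hn => /=; exact: leqnn.
have sub n : (`[a n, +oo[ : set R) `<=` `]0, +oo[.
  by move=> x; rewrite /= !in_itv/= !andbT; apply: lt_le_trans.
have key n : (\int[mu]_(x in `[a n, +oo[) (f x)%:E = (l - F (a n))%:E)%E.
  rewrite EFinB; apply: ge0_continuous_FTC2y => //.
  - by move=> x ax; apply: f0; exact: lt_le_trans ax.
  - apply: continuous_in_subspaceT => x; rewrite inE/= in_itv/= andbT => ax.
    by apply: cf; exact: lt_le_trans ax.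
  - by move=> x ax; have [] := dF x (lt_trans (a0 n) ax).
  - apply: cvg_at_right_filter; apply: differentiable_continuous.
    by apply/derivable1_diffP; have [] := dF _ (a0 n).
  - move=> x; rewrite in_itv/= andbT => ax; rewrite derive1E.
    by have [_ ->] := dF x (lt_trans (a0 n) ax).
rewrite -aU; apply/esym.
apply: (@cvg_unique _ _ (\int[mu]_(x in `[a n, +oo[) (f x)%:E @[n --> \oo])%E) => //=.
- under eq_fun do rewrite key.
  apply: cvg_EFin; first exact: nearW.
  apply: cvgB; first exact: cvg_cst.
  move/cvg_at_rightP: Fl0 => /(_ a); apply; split => //.
  exact: cvg_harmonic.
- apply: ge0_nondecreasing_set_cvg_integral.
  + apply/nondecreasing_seqP => n; apply/subsetPset => x /=.
    rewrite !in_itv/= !andbT; apply: le_trans.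
    by rewrite /a lef_pV2 ?posrE ?ltr0n// ler_nat.
  + by move=> i; exact: measurable_itv.
  + by move=> i; apply: measurable_funS mf => //; exact: sub.
  + move=> i x /=; rewrite in_itv/= andbT => ax; rewrite lee_fin; apply: f0.
    exact: lt_le_trans ax.
Qed.

Lemma gt0_powRD (x r s : R) : 0 < x -> x `^ (r + s) = x `^ r * x `^ s.
Proof. by move=> x0; rewrite powRD// (gt_eqF x0) implybT. Qed.

Lemma powR_le1D (x r : R) (k : nat) : 0 < x -> 0 <= r -> r <= k%:R ->
  x `^ r <= 1 + x ^+ k.
Proof.
move=> x0 r0 rk; have [x1|x1] := leP x 1.
  apply: (@le_trans _ _ 1); last by rewrite lerDl exprn_ge0// ltW.
  have : x `^ r <= 1 `^ r by rewrite ge0_ler_powR// nnegrE ltW.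
  by rewrite powR1.
rewrite -(powR_mulrn _ (ltW x0)) (le_trans (ler_powR (ltW x1) rk))//.
by rewrite lerDr.
Qed.

Lemma powR_le_expR (r : R) : 0 <= r ->
  exists2 C : R, 0 < C & forall x, 0 < x -> x `^ r <= C * expR x.
Proof.
move=> r0; have := archi_boundP r0; set k := Num.bound _ => rk.
exists (1 + k`!%:R); first by rewrite ltr_pwDl// ler0n.
move=> x x0; apply: (le_trans (powR_le1D x0 r0 (ltW rk))).
rewrite mulrDl mul1r lerD//.
  by rewrite -expR0 ler_expR ltW.
case: k {rk} => [|k]; first by rewrite expr0 fact0 mul1r -expR0 ler_expR ltW.
rewrite mulrC -ler_pdivrMr ?ltr0n ?fact_gt0//.
by apply: le_trans (expR_ge1Dxn k (ltW x0)); rewrite lerDr.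
Qed.

(** Derivative of x |-> atan (b x^p - c). It serves as integrable majorant of the
Gamma integrand (b = 1, c = 0) and of a shifted Gaussian in sqrt x (p = 1/2). *)
Definition cauchy_powR (p b c x : R) : R :=
  b * (p * x `^ (p - 1)) / (1 + (b * x `^ p - c) ^+ 2).

Lemma cauchy_powR_ge0 p b c x : 0 <= p -> 0 <= b -> 0 <= cauchy_powR p b c x.
Proof.
move=> p0 b0; rewrite /cauchy_powR !mulr_ge0 ?powR_ge0// invr_ge0.
by rewrite addr_ge0// sqr_ge0.
Qed.

Lemma is_derive_atan_powR (p b c x : R) : 0 < x ->
  is_derive x 1 (fun y => atan (b * y `^ p - c)) (cauchy_powR p b c x).
Proof.
move=> x0.
have dg : is_derive x 1 (fun y => b * y `^ p - c) (b * (p * x `^ (p - 1))).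
  have := is_derive1_powR p x0 => h.
  by apply: is_derive_eq; rewrite subr0.
rewrite /cauchy_powR [X in is_derive _ _ _ X]mulrC.
exact: (is_derive1_comp (is_derive1_atan _) dg).
Qed.

Lemma continuous_powR (p x : R) : 0 < x -> {for x, continuous (fun y : R => y `^ p)}.
Proof.
move=> x0; apply: differentiable_continuous; apply/derivable1_diffP.
by have [] := is_derive1_powR p x0.
Qed.

Lemma continuous_cauchy_powR (p b c x : R) : 0 < x ->
  {for x, continuous (cauchy_powR p b c)}.
Proof.
move=> x0; rewrite /cauchy_powR.
apply: continuousM.
  apply: continuousM; first exact: cst_continuous.
  apply: continuousM; first exact: cst_continuous.
  exact: continuous_powR.
apply: continuousV.
  by rewrite gt_eqF// ltr_wpDr// sqr_ge0.
apply: continuousD; first exact: cst_continuous.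
apply: (@continuous_comp _ _ _ (fun y => b * y `^ p - c) (fun y => y ^+ 2)).
  apply: continuousB; last exact: cst_continuous.
  apply: continuousM; first exact: cst_continuous.
  exact: continuous_powR.
exact: exprn_continuous.
Qed.

Lemma cvgy_powR (p : R) : 0 < p -> x `^ p @[x --> +oo%R] --> +oo%R.
Proof.
move=> p0; apply/cvgryPge => A; near=> x.
have A1 : 0 <= Num.max A 1 by rewrite le_max ler01 orbT.
apply: (@le_trans _ _ (Num.max A 1)); first by rewrite le_max lexx.
rewrite -[leLHS](@powRr1 _ _ A1) -(mulVf (lt0r_neq0 p0)) powRrM.
have xA : Num.max A 1 `^ p^-1 <= x.
  by near: x; apply: nbhs_pinfty_ge; exact: num_real.
by apply: ge0_ler_powR => //; rewrite ?ltW// nnegrE ?(le_trans _ xA)// powR_ge0.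
Unshelve. all: by end_near. Qed.

Lemma integral_cauchy_powR (p b c : R) : 0 < p -> 0 < b ->
  (\int[mu]_(x in `]0%R, +oo[) (cauchy_powR p b c x)%:E =
   (pi / 2 - atan (- c))%:E)%E.
Proof.
move=> p0 b0; apply: (@ge0_integral_FTC_pos _ (fun y => atan (b * y `^ p - c))).
- by move=> x x0; rewrite cauchy_powR_ge0 ?ltW.
- by move=> x x0; exact: continuous_cauchy_powR.
- by move=> x x0; exact: is_derive_atan_powR.
- have h : (b * y `^ p - c) @[y --> 0^'+] --> - c.
    rewrite -[X in _ --> X]add0r; apply: cvgB; last exact: cvg_cst.
    by rewrite -[X in _ --> X](mulr0 b); apply: cvgM; [exact: cvg_cst|exact: powR_cvg0].
  exact: (continuous_cvg _ (@continuous_atan _ _) h).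
- have h : (b * y `^ p - c) @[y --> +oo%R] --> +oo%R.
    apply/cvgryPge => A; near=> y.
    rewrite lerBrDr mulrC -ler_pdivrMr//.
    near: y; move: (cvgy_powR p0) => /cvgryPge; exact.
  by have := cvg_comp _ _ h (cvgy_atan (R:=R)); apply.
Unshelve. all: by end_near. Qed.

End half_line.

(** * The Gamma function *)

Section gamma_function.
Context {R : realType}.
Notation mu := (@lebesgue_measure R).

(** The exponential dominates both x^r and x^(r + 2 a). *)
Lemma powR_expRN_le (a r : R) : 0 < a -> 0 <= r ->
  exists2 C : R, 0 < C & forall x, 0 < x ->
    x `^ (a - 1 + r) * expR (- x) <= C * cauchy_powR a 1 0 x.
Proof.
move=> a0 r0.
have [C1 C10 h1] := powR_le_expR r0.
have ra0 : 0 <= r + (a + a) by rewrite !addr_ge0// ltW.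
have [C2 C20 h2] := powR_le_expR ra0.
exists ((C1 + C2) / a); first by rewrite divr_gt0// addr_gt0.
move=> x x0; have xn0 : x != 0 by rewrite gt_eqF.
have D0 : 0 < 1 + (x `^ a) ^+ 2 by rewrite ltr_pwDl// sqr_ge0.
rewrite /cauchy_powR !mul1r subr0 mulrA ler_pdivlMr//.
have -> : (C1 + C2) / a * (a * x `^ (a - 1)) = (C1 + C2) * x `^ (a - 1).
  by field; rewrite gt_eqF.
have main : x `^ r * expR (- x) * (1 + (x `^ a) ^+ 2) <= C1 + C2.
  rewrite mulrAC expRN ler_pdivrMr ?expR_gt0// mulrDr mulr1 mulrDl lerD ?h1//.
  by rewrite expr2 -!powRD ?xn0 ?implybT// h2.
rewrite powRD ?xn0 ?implybT// [(C1 + _) * _]mulrC -2!mulrA.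
by rewrite ler_wpM2l ?powR_ge0// mulrA.
Qed.

Lemma integrable_cauchy_powR (p b c : R) : 0 < p -> 0 < b ->
  mu.-integrable `]0, +oo[ (EFin \o cauchy_powR p b c).
Proof.
move=> p0 b0; apply/integrableP; split.
  apply/measurable_EFinP; apply: continuous_measurable_pos => x.
  exact: continuous_cauchy_powR.
under eq_integral do rewrite /= ger0_norm ?cauchy_powR_ge0 ?ltW//.
by rewrite integral_cauchy_powR// ltry.
Qed.

Lemma continuous_gamma_integrand (a x : R) : 0 < x ->
  {for x, continuous (fun y : R => y `^ a * expR (- y))}.
Proof.
move=> x0; apply: continuousM; first exact: continuous_powR.
apply: (@continuous_comp _ _ _ (fun y : R => - y) expR).
  exact: opp_continuous.
exact: continuous_expR.
Qed.

Lemma integrable_Gamma (a : R) : 0 < a ->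
  mu.-integrable `]0, +oo[ (EFin \o (fun x => x `^ (a - 1) * expR (- x))).
Proof.
move=> a0; have [C C0 h] := powR_expRN_le a0 (lexx 0).
have ig : mu.-integrable `]0, +oo[ (EFin \o (fun x => C * cauchy_powR a 1 0 x)).
  by apply: (eq_integrable _ _ _ _ (integrableZl _ C (integrable_cauchy_powR 0 a0 ltr01))).
apply: le_integrable ig => //.
- apply/measurable_EFinP; apply: continuous_measurable_pos => x.
  exact: continuous_gamma_integrand.
- move=> x; rewrite /= in_itv/= andbT => x0; rewrite lee_fin.
  rewrite ger0_norm ?mulr_ge0 ?powR_ge0 ?expR_ge0//.
  by rewrite (le_trans _ (ler_norm _))// (le_trans _ (h _ x0))// addr0.
Qed.

Lemma cvgy_powR_expRN (a : R) : 0 < a -> y `^ a * expR (- y) @[y --> +oo%R] --> (0 : R).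
Proof.
move=> a0; have a10 : 0 <= a + 1 by rewrite addr_ge0 ?ltW.
have [C C0 h] := powR_le_expR a10.
apply: (@squeeze_cvgr _ _ _ _ (cst 0) (fun y : R => C / y)).
- near=> y; have y0 : 0 < y by near: y; exact: nbhs_pinfty_gt.
  rewrite mulr_ge0 ?powR_ge0 ?expR_ge0//= ler_pdivlMr// expRN mulrAC.
  rewrite ler_pdivrMr ?expR_gt0// -[X in _ * X](powRr1 (ltW y0)) -powRD ?h//.
  by rewrite (gt_eqF y0) implybT.
- exact: cvg_cst.
- rewrite -[X in _ --> X](mulr0 C); apply: cvgM; first exact: cvg_cst.
  apply/gtr0_cvgV0; last exact: cvg_id.
  by near=> y; near: y; exact: nbhs_pinfty_gt.
Unshelve. all: by end_near. Qed.

(** Integration by parts: a x^(a-1) e^-x - x^a e^-x is the derivative of x^a e^-x,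
which vanishes at both ends of the half-line. As it changes sign, a multiple of
the derivative of atan (x^a) is added to make it nonnegative. *)
Lemma GammaS (a : R) : 0 < a -> Gamma (a + 1) = a * Gamma a.
Proof.
move=> a0; have [C C0 h] := powR_expRN_le a0 (ler01).
pose f x : R := a * (x `^ (a - 1) * expR (- x)) - x `^ (a + 1 - 1) * expR (- x) +
  C * cauchy_powR a 1 0 x.
pose F x : R := x `^ a * expR (- x) + C * atan (1 * x `^ a - 0).
have a1 : a + 1 - 1 = a by rewrite addrK.
have If : (\int[mu]_(x in `]0%R, +oo[) (f x)%:E = (C * (pi / 2) - 0)%:E)%E.
  apply: (@ge0_integral_FTC_pos _ f F).
  - move=> x x0; rewrite /f -addrA addr_ge0//.
      by rewrite !mulr_ge0 ?powR_ge0 ?expR_ge0 ?ltW.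
    rewrite addrC subr_ge0 (le_trans _ (h _ x0))//.
    by rewrite addrAC.
  - move=> x x0; apply: continuousD.
      apply: continuousB; last exact: continuous_gamma_integrand.
      apply: continuousM; first exact: cst_continuous.
      exact: continuous_gamma_integrand.
    apply: continuousM; first exact: cst_continuous.
    exact: continuous_cauchy_powR.
  - move=> x x0.
    have d1 := is_derive1_powR a x0.
    have d2 := is_derive_atan_powR a 1 0 x0.
    rewrite /F; apply: is_derive_eq.
    rewrite /f a1 /GRing.scale/=; ring.
  - rewrite -[X in _ --> X](addr0 0); apply: cvgD.
      rewrite -[X in _ --> X](mul0r (expR (- 0))); apply: cvgM; first exact: powR_cvg0.
      apply: cvg_at_right_filter.
      apply: (@continuous_comp _ _ _ (fun y : R => - y) expR).
        exact: opp_continuous.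
      exact: continuous_expR.
    rewrite -[X in _ --> X](mulr0 C); apply: cvgM; first exact: cvg_cst.
    rewrite -[X in _ --> X]atan0.
    apply: (continuous_cvg _ (@continuous_atan _ _)).
    under eq_fun do rewrite subr0 mul1r.
    exact: powR_cvg0.
  - rewrite -[X in _ --> X](add0r); apply: cvgD; first exact: cvgy_powR_expRN.
    apply: cvgM; first exact: cvg_cst.
    under eq_fun do rewrite subr0 mul1r.
    have := cvg_comp _ _ (cvgy_powR a0) (cvgy_atan (R:=R)); exact.
have i1 := integrable_Gamma a0.
have i2 := integrable_Gamma (addr_gt0 a0 ltr01).
have i3 := integrable_cauchy_powR 0 a0 ltr01.
have i1' : mu.-integrable `]0, +oo[ (EFin \o (fun x => a * (x `^ (a - 1) * expR (- x)))).
  by apply: (eq_integrable _ _ _ _ (integrableZl _ a i1)).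
have i3' : mu.-integrable `]0, +oo[ (EFin \o (fun x => C * cauchy_powR a 1 0 x)).
  by apply: (eq_integrable _ _ _ _ (integrableZl _ C i3)).
have i12 : mu.-integrable `]0, +oo[ (EFin \o (fun x => a * (x `^ (a - 1) * expR (- x))
    - x `^ (a + 1 - 1) * expR (- x))).
  by apply: (eq_integrable _ _ _ _ (integrableB _ i1' i2)).
have : \int[mu]_(x in `]0, +oo[) f x = C * (pi / 2).
  by rewrite /Rintegral If subr0.
rewrite RintegralD// RintegralB// !RintegralZl//.
rewrite [X in _ + C * X](_ : _ = pi / 2); last first.
  by rewrite /Rintegral integral_cauchy_powR//= oppr0 atan0 subr0.
rewrite /Gamma; move=> /(canRL (addrK _)); rewrite subrr => /eqP.
by rewrite subr_eq0 => /eqP ->.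
Qed.

(** A null integral would force the positive integrand to vanish almost everywhere. *)
Lemma Gamma_gt0 (a : R) : 0 < a -> 0 < Gamma a.
Proof.
move=> a0; have iG := integrable_Gamma a0.
rewrite /Gamma lt_neqAle Gamma_ge0 andbT; apply/negP; rewrite eq_sym => /eqP.
rewrite /Rintegral => h.
have : (\int[mu]_(x in `]0%R, +oo[) `|(x `^ (a - 1) * expR (- x))%:E| = 0)%E.
  under eq_integral do rewrite abse_EFin ger0_norm ?mulr_ge0 ?powR_ge0 ?expR_ge0//.
  by rewrite -[LHS]fineK ?h//; exact: integrable_fin_num.
move/(ae_eq_integral_abs _ _ (measurable_int _ iG)) => hae.
have : mu.-negligible (`]0, 1] : set R).
  apply: negligibleS (hae (measurable_itv _)) => x /=.
  move=> /andP[]; rewrite bnd_simp => x0 _.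
  rewrite in_itv/= x0 => /(_ isT) [] /eqP.
  by rewrite mulf_eq0 gt_eqF ?powR_gt0// gt_eqF ?expR_gt0.
move/negligibleP => /(_ (measurable_itv _)) /=.
rewrite lebesgue_measure_itv/= lte_fin ltr01 => /eqP.
by rewrite -EFinD subr0 eqe oner_eq0.
Qed.

(** Convexity of exp between ln y and 0. *)
Lemma powR_bernoulli (y q : R) : 0 < y -> 0 <= q <= 1 -> y `^ q <= 1 + q * (y - 1).
Proof.
move=> y0 q01; pose t := Itv01 (proj1 (andP q01)) (proj2 (andP q01)).
have := @convex_expR R t (ln y) 0.
rewrite !convRE/= /unstable.onem mulr0 addr0 expR0 mulr1 lnK ?posrE// => h.
rewrite /powR gt_eqF// (le_trans h)// mulrBr mulr1 addrCA addrA.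
by rewrite lerD2r addrC.
Qed.

(** Lower half of the equivalence Gamma (sigma + n) ~ n! n^(sigma - 1). For
sigma <= 1 the quotient of the two sides is nondecreasing in n, by Bernoulli's
inequality; from sigma - 1 to sigma the functional equation brings a factor
sigma - 1 + n >= n. *)
Lemma Gamma_growth (sigma : R) : 0 < sigma ->
  exists2 c : R, 0 < c & forall n, (0 < n)%N ->
    c * n`!%:R * n%:R `^ (sigma - 1) <= Gamma (sigma + n%:R).
Proof.
move=> s0; have [N sN] : exists N : nat, sigma <= N.+1%:R.
  by exists (Num.bound sigma); rewrite (le_trans (ltW (archi_boundP (ltW s0))))// ler_nat.
elim: N sigma s0 sN => [|N IH] sigma s0 sN; last first.
  have [s1|s1] := leP sigma N.+1%:R; first exact: IH.
  have s10 : 0 < sigma - 1.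
    by rewrite subr_gt0 (le_lt_trans _ s1)// ler1n.
  have [||c c0 h] := IH (sigma - 1) => //.
    by rewrite lerBlDr natr1.
  exists c => // n n0.
  have nR : 0 < n%:R :> R by rewrite ltr0n.
  have -> : sigma + n%:R = sigma - 1 + n%:R + 1 by ring.
  rewrite GammaS; last exact: addr_gt0.
  have -> : n%:R `^ (sigma - 1) = n%:R * n%:R `^ (sigma - 1 - 1) :> R.
    by rewrite mulr_powRB1// ltW.
  rewrite mulrCA; apply: ler_pM.
  - by rewrite ltW.
  - by rewrite !mulr_ge0 ?powR_ge0// ltW.
  - by rewrite lerDr ltW.
  - exact: h.
(* Base case sigma <= 1: the constant is the quotient at n = 1. *)
exists (Gamma (sigma + 1)); first by rewrite Gamma_gt0// addr_gt0.
case=> // n _; elim: n => [|n IH].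
  by rewrite powR1 mulr1 mulr1.
have nR : 0 < n.+1%:R :> R by rewrite ltr0n.
have nR' : 0 < n.+2%:R :> R by rewrite ltr0n.
have -> : sigma + n.+2%:R = sigma + n.+1%:R + 1 by rewrite -[in LHS]natr1; ring.
rewrite (GammaS (addr_gt0 s0 nR)).
apply: le_trans (ler_wpM2l (ltW (addr_gt0 s0 nR)) IH).
rewrite [n.+2`!]factS natrM.
have -> : n.+2%:R `^ (sigma - 1) =
    (n.+1%:R / n.+2%:R) `^ (1 - sigma) * n.+1%:R `^ (sigma - 1) :> R.
  rewrite powRM ?invr_ge0 ?ler0n// mulrAC -powRD ?pnatr_eq0 ?implybT//.
  rewrite addrCA addrAC subrr add0r subrr powRr0 mul1r.
  by rewrite -powR_inv1 ?ler0n// -powRrM mulN1r opprB.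
have /powR_bernoulli : 0 < (n.+1%:R / n.+2%:R : R) by rewrite divr_gt0.
move=> /(_ (1 - sigma)) h.
have {}h : (n.+1%:R / n.+2%:R) `^ (1 - sigma) * n.+2%:R <= sigma + n.+1%:R.
  have hs : 0 <= 1 - sigma <= 1 by rewrite subr_ge0 sN gerBl ltW.
  rewrite -ler_pdivlMr// (le_trans (h hs))// le_eqVlt; apply/orP; left; apply/eqP.
  have hm : n.+1%:R = n.+2%:R - 1 :> R by rewrite -[in RHS]natr1 addrK.
  rewrite hm; move: (n.+2%:R : R) nR' => m m0.
  by field; rewrite gt_eqF.
rewrite [leLHS](_ : _ = Gamma (sigma + 1) * n.+1`!%:R * n.+1%:R `^ (sigma - 1) *
   ((n.+1%:R / n.+2%:R) `^ (1 - sigma) * n.+2%:R)); last by ring.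
rewrite [leRHS]mulrC ler_wpM2l// !mulr_ge0 ?powR_ge0 ?ler0n ?Gamma_ge0//.
Qed.

(** The bound 4^n / sqrt n on the central binomial coefficient. The induction runs
on squares and with 2 n + 1 in place of n, where its step amounts to
(2 n + 1) (2 n + 3) <= (2 n + 2)^2. *)
Lemma central_factorial (n : nat) :
  (n.*2)`!%:R * n%:R `^ 2^-1 <= 4 ^+ n * n`!%:R ^+ 2 :> R.
Proof.
have h : ((n.*2)`! ^ 2 * n.*2.+1 <= (4 ^ n * n`! ^ 2) ^ 2)%N.
  elim: n => // n IH.
  rewrite doubleS !factS (expnS 4).
  apply: (@leq_trans ((n.*2)`! ^ 2 * n.*2.+1 * (16 * n.+1 ^ 4))); last first.
    rewrite [X in (_ <= X)%N](_ : _ = ((4 ^ n * n`! ^ 2) ^ 2 * (16 * n.+1 ^ 4))%N); last by ring.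
    by rewrite leq_mul2r IH orbT.
  rewrite -!muln2.
  have : (((n * 2).+1 * (n * 2).+3) <= 4 * n.+1 ^ 2)%N by nia.
  set f := (n * 2)`! => k.
  have -> : (((n * 2).+2 * ((n * 2).+1 * f)) ^ 2 * (n * 2).+3 =
    f ^ 2 * (n * 2).+1 * (4 * n.+1 ^ 2 * ((n * 2).+1 * (n * 2).+3)))%N by ring.
  rewrite leq_mul2l; apply/orP; right.
  rewrite (_ : (16 * n.+1 ^ 4 = 4 * n.+1 ^ 2 * (4 * n.+1 ^ 2))%N); last by ring.
  by rewrite leq_mul2l k orbT.
have h0 : 0 <= 4 ^+ n * n`!%:R ^+ 2 :> R by rewrite mulr_ge0// exprn_ge0.
rewrite -(@ler_pXn2r _ 2) ?nnegrE ?mulr_ge0 ?powR_ge0//.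
rewrite exprMn -(powR_mulrn 2 (powR_ge0 _ _)) -powRrM mulVf// powRr1//.
apply: (@le_trans _ _ ((n.*2)`!%:R ^+ 2 * n.*2.+1%:R)).
  rewrite ler_wpM2l ?sqr_ge0// ler_nat -addnn; exact: leq_trans (leq_addr _ _) (leqnSn _).
by move: h; rewrite -(ler_nat R) natrM !natrX natrM !natrX.
Qed.

End gamma_function.

(** * A Bessel-type bound for the kernel coefficients *)

Section bessel_bound.
Context {R : realType}.

Lemma exp_coeff_partial_sum_le (r : R) n : 0 <= r ->
  \sum_(0 <= i < n) exp_coeff r i <= expR r.
Proof.
move=> r0; apply: (nondecreasing_cvgn_le _ (is_cvg_series_exp_coeff r)).
by apply: nondecreasing_series => i _ _; exact: exp_coeff_ge0.
Qed.

Lemma sum_stride_le (f : nat -> R) k N : (forall i, 0 <= f i) ->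
  \sum_(j < N) f (j.*2 + k)%N <= \sum_(0 <= i < N.*2 + k) f i.
Proof.
move=> f0; elim: N => [|N IH]; first by rewrite big_ord0 sumr_ge0.
rewrite big_ord_recr doubleS !addSn !big_nat_recr//= -addrA lerD// lerDl.
exact: f0.
Qed.

Lemma sum_exp_coeff_stride_le (r : R) k N : 0 <= r ->
  \sum_(j < N) exp_coeff r (j.*2 + k)%N <= expR r.
Proof.
move=> r0; apply: le_trans (exp_coeff_partial_sum_le (N.*2 + k) r0).
by apply: sum_stride_le => i; exact: exp_coeff_ge0.
Qed.

Lemma fact_addn_le m k : ((m + k)`! <= m`! * (m + k) ^ k)%N.
Proof.
elim: k => [|k IH]; first by rewrite addn0 expn0 muln1.
rewrite addnS factS expnS mulnCA leq_mul2l /=.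
apply: (leq_trans IH); rewrite leq_mul2l; apply/orP; right.
by case: k {IH} => // k; rewrite leq_exp2r.
Qed.

Lemma powR_le_invD (y p : R) (k : nat) : 0 < y -> -1 <= p -> p <= k%:R ->
  y `^ p <= y^-1 + y ^+ k.
Proof.
move=> y0 p1 pk; rewrite -(powR_inv1 (ltW y0)) -(powR_mulrn _ (ltW y0)).
have [y1|y1] := leP y 1.
  by rewrite (le_trans (ger_powR _ p1)) ?y0// lerDl powR_ge0.
by rewrite (le_trans (ler_powR (ltW y1) pk))// lerDr powR_ge0.
Qed.

(** A power of r / n is at most n / r plus a natural power (r / n)^k. Up to
constants, multiplying r^(2n) / (2n)! by n / r lowers its index by one and
multiplying it by (r / n)^k raises its index by k. *)
Lemma weighted_exp_coeff_le (p : R) : -1 <= p ->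
  exists k : nat, forall (r : R) n, 0 < r -> (0 < n)%N ->
    exp_coeff r n.*2 * (r / n%:R) `^ p <=
    exp_coeff r n.*2.-1 + k.+2%:R ^+ k * exp_coeff r (n.*2 + k).
Proof.
move=> p1; exists (Num.bound `|p|).
set k := Num.bound _; have pk : p <= k%:R.
  by rewrite (le_trans (ler_norm _))// ltW// archi_boundP.
move=> r [//|n] r0 _; set m : nat := n.+1.
have m0 : 0 < m%:R :> R by rewrite ltr0n.
have rm0 : 0 < r / m%:R by rewrite divr_gt0.
apply: (le_trans (ler_wpM2l (exp_coeff_ge0 _ (ltW r0)) (powR_le_invD rm0 p1 pk))).
rewrite mulrDr lerD//.
  rewrite /exp_coeff /m doubleS /= factS natrM exprS.
  have F0 : 0 < (n.*2.+1)`!%:R :> R by rewrite ltr0n fact_gt0.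
  have -> : n.*2.+2%:R = n.+1%:R * 2 :> R by rewrite -natrM -doubleS muln2.
  have -> : r * r ^+ n.*2.+1 / (n.+1%:R * 2 * (n.*2.+1)`!%:R) * (r / n.+1%:R)^-1 =
    r ^+ n.*2.+1 / (n.*2.+1)`!%:R / 2.
    by move: F0; rewrite -[n.+1]/m; move: ((n.*2.+1)`!%:R : R) (m%:R : R) m0
      => F M M0 F0; field; rewrite !gt_eqF.
  rewrite ler_pdivrMr// ler_peMr ?ler1n//.
  by rewrite divr_ge0 ?exprn_ge0 ?ltW.
rewrite /exp_coeff /= exprMn exprD exprVn.
have F0 : 0 < (m.*2)`!%:R :> R by rewrite ltr0n fact_gt0.
have G0 : 0 < (m.*2 + k)`!%:R :> R by rewrite ltr0n fact_gt0.
have M0 : 0 < m%:R ^+ k :> R by rewrite exprn_gt0.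
have X0 : 0 <= r ^+ m.*2 * r ^+ k by rewrite mulr_ge0 ?exprn_ge0 ?ltW.
have FG : (m.*2 + k)`!%:R <= (m.*2)`!%:R * (m%:R ^+ k * k.+2%:R ^+ k) :> R.
  rewrite -exprMn -natrM -natrX -natrM ler_nat.
  apply: (leq_trans (fact_addn_le _ _)); rewrite leq_mul2l; apply/orP; right.
  case: k {pk M0 X0 G0} => // k; rewrite leq_exp2r// /m; nia.
move: M0 F0 G0 X0 FG.
move: (m%:R ^+ k : R) ((m.*2)`!%:R : R) ((m.*2 + k)`!%:R : R)
  (k.+2%:R ^+ k : R) => M F G L M0 F0 G0.
rewrite [r ^+ m.*2 / F * _](_ : _ = r ^+ m.*2 * r ^+ k / (F * M)); last first.
  by field; rewrite !gt_eqF.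
move: (_ * r ^+ k) => X X0 FG.
rewrite mulrCA ler_wpM2l// ler_pdivlMr// mulrC ler_pdivrMr ?mulr_gt0//.
by rewrite mulrC -mulrA.
Qed.

(** Modulus of the coefficient of (t s x)^n in the integrand of the kernel, with the
cosine bounded by 1. *)
Definition kernel_coeff (sigma : R) (n : nat) : R :=
  Gamma sigma / (n`!%:R * Gamma (sigma + n%:R)).

Lemma kernel_coeff_ge0 sigma n : 0 <= kernel_coeff sigma n.
Proof. by rewrite divr_ge0 ?mulr_ge0 ?Gamma_ge0. Qed.

(** A one-sided duplication formula: n! Gamma (sigma + n) is at least of order
4^-n (2n)! n^(sigma - 1/2). *)
Lemma kernel_coeff_le (sigma : R) : 0 < sigma ->
  exists2 C : R, 0 < C & forall n, (0 < n)%N ->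
    kernel_coeff sigma n <= C * (4 ^+ n / ((n.*2)`!%:R * n%:R `^ (sigma - 2^-1))).
Proof.
move=> s0; have [c c0 h] := Gamma_growth s0.
exists (Gamma sigma / c); first by rewrite divr_gt0// Gamma_gt0.
move=> n n0; rewrite /kernel_coeff.
have nR : 0 < n%:R :> R by rewrite ltr0n.
have G0 : 0 < Gamma (sigma + n%:R) by rewrite Gamma_gt0// addr_gt0.
have F0 : 0 < n`!%:R :> R by rewrite ltr0n fact_gt0.
have F20 : 0 < (n.*2)`!%:R :> R by rewrite ltr0n fact_gt0.
have P0 : 0 < n%:R `^ (sigma - 2^-1) :> R by rewrite powR_gt0.
have key : c * ((n.*2)`!%:R * n%:R `^ (sigma - 2^-1)) <=
    4 ^+ n * (n`!%:R * Gamma (sigma + n%:R)).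
  have -> : sigma - 2^-1 = 2^-1 + (sigma - 1) by field.
  rewrite powRD ?(gt_eqF nR) ?implybT//.
  apply: (@le_trans _ _ (c * (4 ^+ n * n`!%:R ^+ 2 * n%:R `^ (sigma - 1)))).
    rewrite ler_wpM2l ?(ltW c0)// mulrA ler_wpM2r ?powR_ge0//.
    exact: central_factorial.
  rewrite (_ : c * _ = 4 ^+ n * (n`!%:R * (c * n`!%:R * n%:R `^ (sigma - 1)))); last by ring.
  by rewrite ler_wpM2l ?exprn_ge0// ler_wpM2l ?(ltW F0)// h.
rewrite -!mulrA ler_wpM2l ?Gamma_ge0// mulrA.
rewrite ler_pdivlMr ?mulr_gt0// mulrC ler_pdivrMr ?mulr_gt0//.
by rewrite -mulrA [leRHS]mulrC ler_pdivlMr// mulrC.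
Qed.

Definition kernel_majorant (sigma v : R) : R :=
  v `^ (4^-1 - sigma / 2) * expR (2 * Num.sqrt v).

(** The series is a modified Bessel function of 2 sqrt v up to a power of v, and the
bound has its order of growth at +oo. It holds down to v = 0 because the constant
term is left out: for sigma < 1/2 the right-hand side tends to 0 there. *)
Lemma kernel_series_bound (sigma : R) : 0 < sigma ->
  exists2 A : R, 0 < A & forall v N, 0 < v ->
    \sum_(j < N) kernel_coeff sigma j.+1 * v ^+ j.+1 <=
    A * kernel_majorant sigma v.
Proof.
move=> s0; have [C C0 hC] := kernel_coeff_le s0.
set p := sigma - 2^-1.
have p1 : -1 <= p by rewrite /p; lra.
have [k hk] := weighted_exp_coeff_le p1.
pose L : R := k.+2%:R ^+ k.
have L0 : 0 <= L by rewrite exprn_ge0.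
exists (C * 2 `^ (- p) * (1 + L)).
  by rewrite !mulr_gt0 ?powR_gt0// ltr_pwDl.
move=> v N v0; rewrite /kernel_majorant; set r := 2 * Num.sqrt v.
have sv0 : 0 < Num.sqrt v by rewrite sqrtr_gt0.
have r0 : 0 < r by rewrite mulr_gt0.
have -> : v `^ (4^-1 - sigma / 2) = (Num.sqrt v) `^ (- p).
  by rewrite -(powR12_sqrt (ltW v0)) -powRrM; congr (_ `^ _); rewrite /p; field.
have -> : C * 2 `^ (- p) * (1 + L) * (Num.sqrt v `^ (- p) * expR r) =
   C * r `^ (- p) * (expR r + L * expR r).
  by rewrite /r powRM ?(ltW sv0)//; ring.
have term n : (0 < n)%N -> kernel_coeff sigma n * v ^+ n <=
    C * r `^ (- p) * (exp_coeff r n.*2.-1 + L * exp_coeff r (n.*2 + k)).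
  move=> n0; apply: (le_trans (ler_wpM2r _ (hC _ n0))); first by rewrite exprn_ge0 ?ltW.
  have nR : 0 < n%:R :> R by rewrite ltr0n.
  have P0 : 0 < n%:R `^ p :> R by rewrite powR_gt0.
  have Q0 : 0 < r `^ p :> R by rewrite powR_gt0.
  have F20 : 0 < (n.*2)`!%:R :> R by rewrite ltr0n fact_gt0.
  apply: (@le_trans _ _ (C * r `^ (- p) * (exp_coeff r n.*2 * (r / n%:R) `^ p))); last first.
    by rewrite ler_wpM2l ?hk// mulr_ge0 ?powR_ge0 ?ltW.
  rewrite le_eqVlt; apply/orP; left; apply/eqP.
  have -> : v ^+ n = r ^+ n.*2 / 4 ^+ n.
    have -> : r ^+ n.*2 = (4 * v) ^+ n.
      rewrite -mul2n exprM; congr (_ ^+ _).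
      by rewrite /r exprMn sqr_sqrtr ?(ltW v0)// -natrX.
    by rewrite exprMn mulrAC divff ?mul1r// expf_neq0.
  have -> : (r / n%:R) `^ p = r `^ p / n%:R `^ p.
    rewrite powRM ?invr_ge0 ?(ltW nR) ?(ltW r0)//.
    by rewrite -(powR_inv1 (ltW nR)) -powRrM mulN1r powRN.
  rewrite powRN /exp_coeff /= -/p.
  field.
  by rewrite !gt_eqF// exprn_gt0.
apply: (@le_trans _ _ (\sum_(j < N) C * r `^ (- p) *
    (exp_coeff r (j.*2 + 1)%N + L * exp_coeff r (j.*2 + k.+2)%N))).
  apply: ler_sum => j _; apply: le_trans (term _ _) _ => //.
  by rewrite doubleS /= addn1 !addnS ?addSn.
rewrite -mulr_sumr ler_wpM2l ?mulr_ge0 ?powR_ge0 ?(ltW C0)//.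
rewrite big_split/= -mulr_sumr lerD ?ler_wpM2l//.
  exact: sum_exp_coeff_stride_le (ltW r0).
exact: sum_exp_coeff_stride_le (ltW r0).
Qed.

End bessel_bound.

(** * The kernel as a power series *)

Section kernel_power_series.
Context {R : realType}.
Notation mu := (@lebesgue_measure R).

Lemma kernel_series_bounded (sigma : R) : 0 < sigma -> forall y, 0 <= y ->
  exists Q : R, forall N, \sum_(0 <= n < N) kernel_coeff sigma n * y ^+ n <= Q.
Proof.
move=> s0 y y0; have [A A0 hA] := kernel_series_bound s0.
have y10 : 0 < y + 1 by rewrite ltr_wpDl.
exists (kernel_coeff sigma 0 + A * kernel_majorant sigma (y + 1)).
move=> [|N].
  rewrite big_nil addr_ge0 ?kernel_coeff_ge0// mulr_ge0 ?(ltW A0)//.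
  by rewrite mulr_ge0 ?powR_ge0 ?expR_ge0.
rewrite big_mkord big_ord_recl expr0 mulr1 lerD2l.
apply: le_trans (hA _ N y10); apply: ler_sum => j _.
rewrite ler_wpM2l ?kernel_coeff_ge0//.
by rewrite lerXn2r ?nnegrE ?(ltW y10)// lerDl.
Qed.

Lemma admissible_integrableM (omega h : R -> R) (B : R) : admissible omega ->
  measurable_fun (`[-1, 1] : set R) h ->
  (forall s, -1 <= s <= 1 -> `|h s| <= B) ->
  mu.-integrable `[-1, 1] (fun s => (omega s * h s)%:E).
Proof.
move=> [mom om0 [M omM] _] mh hB.
apply: measurable_bounded_integrable => //.
- by rewrite /= lebesgue_measure_itv/=; case: ifP => _; rewrite ?ltry// -EFinD ltry.
- exact: measurable_funM.
- exists (M * B); split; first exact: num_real.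
  move=> x Mx s; rewrite /= in_itv/= => s1; apply: le_trans (ltW Mx).
  rewrite normrM ger0_norm ?om0// ler_pM ?om0// ?omM//.
  exact: hB.
Qed.

(** Dominated convergence in s: the partial sums are bounded by a convergent
majorant series, uniformly for s in [-1, 1]. *)
Lemma K_power_series (sigma theta0 : R) (omega : R -> R) (t : R) :
  0 < sigma -> admissible omega -> 0 <= t ->
  exists2 c : nat -> R, (forall n, `|c n| <= kernel_coeff sigma n * t ^+ n) &
    forall x, \sum_(0 <= n < N) c n * x ^+ n @[N --> \oo] -->
      K sigma theta0 omega t x.
Proof.
move=> s0 hom t0; have [mom om0 _ om1] := hom.
pose b (n : nat) (s : R) : R := kernel_coeff sigma n * (- t * s) ^+ n *
  cos (pi / 2 * n%:R + t * s / (1 - theta0)).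
pose a (x : R) (n : nat) (s : R) : R := (- t * s * x) ^+ n * Gamma sigma *
  cos (pi / 2 * n%:R + t * s / (1 - theta0)) / (n`!%:R * Gamma (sigma + n%:R)).
have aE x n s : a x n s = b n s * x ^+ n.
  by rewrite /a /b /kernel_coeff exprMn; ring.
have b_le n s : -1 <= s <= 1 -> `|b n s| <= kernel_coeff sigma n * t ^+ n.
  move=> s1; rewrite /b; set y := _ + _.
  have c1 : `|cos y| <= 1 by rewrite ler_norml cos_geN1 cos_le1.
  rewrite 2!normrM ger0_norm ?kernel_coeff_ge0//.
  rewrite -mulrA ler_wpM2l ?kernel_coeff_ge0// -[leRHS]mulr1 ler_pM//.
  rewrite normrX normrM normrN (ger0_norm t0) lerXn2r ?nnegrE ?mulr_ge0//.
  by rewrite ler_piMr// ler_norml.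
have cb n s : {for s, continuous (b n)}.
  rewrite /b; apply: continuousM.
    apply: continuousM; first exact: cst_continuous.
    apply: (@continuous_comp _ _ _ (fun s : R => - t * s) (fun y : R => y ^+ n)).
      exact: mulrl_continuous.
    exact: exprn_continuous.
  apply: (@continuous_comp _ _ _ (fun s : R => pi / 2 * n%:R + t * s / (1 - theta0)) cos).
    apply: continuousD; first exact: cst_continuous.
    apply: (@continuous_comp _ _ _ (fun s : R => t * s) (fun y : R => y / (1 - theta0))).
      exact: mulrl_continuous.
    exact: mulrr_continuous.
  exact: continuous_cos.
have mb n : measurable_fun (`[-1, 1] : set R) (b n).
  by apply: measurable_funTS; apply: continuous_measurable_fun => s; exact: cb.
have ib n : mu.-integrable `[-1, 1] (EFin \o (fun s => omega s * b n s)).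
  exact: admissible_integrableM (b_le n).
pose c n := \int[mu]_(s in `[-1, 1]) (omega s * b n s).
have iom : mu.-integrable `[-1, 1] (EFin \o omega).
  have : forall s, -1 <= s <= 1 -> `|(cst 1 : R -> R) s| <= 1 by move=> s _ /=; rewrite normr1.
  move=> /(admissible_integrableM hom (@measurable_cst _ _ _ _ _ _)).
  by apply: eq_integrable => // s _ /=; rewrite mulr1.
exists c => [n|x].
  apply: (le_trans (le_normr_Rintegral _ (ib n))) => //.
  have -> : kernel_coeff sigma n * t ^+ n =
     \int[mu]_(s in `[-1, 1]) (kernel_coeff sigma n * t ^+ n * omega s).
    by rewrite RintegralZl// om1 mulr1.
  apply: le_Rintegral => //.
  - by have := integrable_norm (ib n).
  - by apply: (eq_integrable _ _ _ _ (integrableZl _ (kernel_coeff sigma n * t ^+ n) iom)).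
  - move=> s; rewrite /= in_itv/= => s1.
    by rewrite normrM ger0_norm ?om0// mulrC ler_wpM2r ?om0// b_le.
have [Q hQ] := kernel_series_bounded s0 (mulr_ge0 t0 (normr_ge0 x)).
have a_le n s : -1 <= s <= 1 -> `|a x n s| <= kernel_coeff sigma n * (t * `|x|) ^+ n.
  move=> s1; rewrite aE normrM normrX exprMn mulrA ler_wpM2r ?exprn_ge0//.
  exact: b_le.
pose S (N : nat) (s : R) : R := \sum_(0 <= n < N) a x n s.
have S_le N s : -1 <= s <= 1 -> `|S N s| <= Q.
  move=> s1; rewrite /S (le_trans (ler_norm_sum _ _ _))// (le_trans _ (hQ N))//.
  by apply: ler_sum => n _; exact: a_le.
have cvS s : -1 <= s <= 1 -> cvgn (series (a x ^~ s)).
  move=> s1; apply: normed_cvg; apply: nondecreasing_is_cvgn.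
    apply: nondecreasing_series => n _ _; exact: normr_ge0.
  exists Q => _ [N _ <-]; apply: le_trans (hQ N).
  by rewrite /series/=; apply: ler_sum => n _; exact: a_le.
have mS N : measurable_fun (`[-1, 1] : set R) (S N).
  apply: measurable_sum => n; rewrite (_ : a x n = fun s => b n s * x ^+ n).
    exact: measurable_funM.
  by apply/funext => s; rewrite aE.
have iS N : mu.-integrable `[-1, 1] (fun s => (omega s * S N s)%:E).
  exact: admissible_integrableM (S_le N).
have intS N : \int[mu]_(s in `[-1, 1]) (omega s * S N s) =
    \sum_(0 <= n < N) c n * x ^+ n.
  elim: N => [|N IH].
    rewrite big_nil; under eq_Rintegral do rewrite /S big_nil mulr0.
    by rewrite Rintegral_cst// mul0r.
  rewrite big_nat_recr//= -IH -RintegralZr// -RintegralD//.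
  - by apply: eq_Rintegral => s _; rewrite /S big_nat_recr//= aE; ring.
  - exact: iS.
  - by apply: (eq_integrable _ _ _ _ (integrableZr _ (x ^+ N) (ib N))).
under eq_fun do rewrite -intS.
rewrite /K /Rintegral.
have iQ : mu.-integrable `[-1, 1] (fun s => (omega s * Q)%:E).
  apply: admissible_integrableM (fun _ _ => lexx `|Q|) => //.
have cvoS s : -1 <= s <= 1 ->
    (omega s * S N s)%:E @[N --> \oo] --> (omega s * limn (series (a x ^~ s)))%:E.
  move=> s1; apply: cvg_EFin; first exact: nearW.
  by apply: cvgM; [exact: cvg_cst|exact: cvS].
have mlim : measurable_fun (`[-1, 1] : set R)
    (fun s => (omega s * limn (series (a x ^~ s)))%:E).
  apply: (emeasurable_fun_cvg (fun N s => (omega s * S N s)%:E)).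
    by move=> N; exact: measurable_int (iS N).
  by move=> s; rewrite /= in_itv/=; exact: cvoS.
have [] := @dominated_convergence _ _ _ mu _ (measurable_itv _) _ _ _
  (fun N => measurable_int _ (iS N)) mlim _ iQ.
- by apply: aeW => s; rewrite /= in_itv/=; exact: cvoS.
- apply: aeW => s N; rewrite /= in_itv/= => s1; rewrite lee_fin.
  by rewrite normrM ger0_norm ?om0// ler_wpM2l ?om0// S_le.
move=> iK _ cK; apply: fine_cvg; rewrite fineK//.
exact: integrable_fin_num.
Qed.

End kernel_power_series.

(** * The second moment of the kernel under the Gamma law *)

Section second_moment.
Context {R : realType}.
Notation mu := (@lebesgue_measure R).

Lemma measurable_K (sigma theta0 : R) (omega : R -> R) (t : R) :
  0 < sigma -> admissible omega -> 0 <= t ->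
  measurable_fun setT (K sigma theta0 omega t).
Proof.
move=> s0 hom t0; have [c _ hc] := K_power_series theta0 s0 hom t0.
apply: (@measurable_fun_cvg _ _ R setT (fun (N : nat) (x : R) => \sum_(0 <= n < N) c n * x ^+ n)).
  move=> N; apply: measurable_sum => n.
  by apply: measurable_funM => //; exact: exprn_measurable.
by move=> x _; exact: hc.
Qed.

(** For n >= 1 and t <= b one has t^n = (t / b)^n b^n <= (t / b) b^n. The gain t / b
is what makes the variance small when t is small compared with b. *)
Lemma K_dist_le (sigma : R) : 0 < sigma -> exists2 A : R, 0 < A &
  forall theta0 omega t, admissible omega -> 0 <= t ->
  exists c0 : R, forall b x, 0 < b -> t <= b -> 0 < x ->
    `|K sigma theta0 omega t x - c0| <= t / b * (A * kernel_majorant sigma (b * x)).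
Proof.
move=> s0; have [A A0 hA] := kernel_series_bound s0; exists A => //.
move=> theta0 omega t hom t0; have [c c_le hc] := K_power_series theta0 s0 hom t0.
exists (c 0%N) => b x b0 tb x0.
have hcS : `|\sum_(0 <= n < N.+1) c n * x ^+ n - c 0%N| @[N --> \oo] -->
    `|K sigma theta0 omega t x - c 0%N|.
  apply: cvg_norm; apply: cvgB; last exact: cvg_cst.
  by rewrite (cvg_shiftS (fun N => \sum_(0 <= n < N) c n * x ^+ n)); exact: hc.
apply: (ler_cvg_to hcS (cvg_cst _)); apply: nearW => N.
rewrite big_mkord big_ord_recl expr0 mulr1 addrAC subrr add0r.
apply: (le_trans (ler_norm_sum _ _ _)).
apply: le_trans (ler_wpM2l _ (hA (b * x) N (mulr_gt0 b0 x0))); last by rewrite divr_ge0 ?(ltW b0).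
rewrite mulr_sumr; apply: ler_sum => j _; rewrite ?lift0.
rewrite normrM normrX (gtr0_norm x0).
apply: (le_trans (ler_wpM2r _ (c_le _))); first by rewrite exprn_ge0 ?ltW.
rewrite mulrCA -mulrA ler_wpM2l ?kernel_coeff_ge0//.
rewrite exprMn mulrA ler_wpM2r ?exprn_ge0 ?(ltW x0)//.
rewrite exprS [b ^+ _]exprS mulrA divfK ?gt_eqF//.
by rewrite ler_wpM2l// lerXn2r ?nnegrE// ltW.
Qed.

Lemma expRN_sqr_le (u : R) : expR (- u ^+ 2) <= (1 + u ^+ 2)^-1.
Proof.
by rewrite expRN lef_pV2 ?posrE ?expR_gt0 ?expR_ge1Dx// ltr_wpDr// sqr_ge0.
Qed.

(** The powers of x combine to x^(-1/2) and the exponents to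
4 sqrt(b x) - a x = 4 b / a - u^2 with a = 1 - theta and
u = sqrt(a x) - 2 sqrt(b / a); then exp(-u^2) <= 1 / (1 + u^2). *)
Lemma majorant_pdf_le (sigma theta b x : R) : 0 < sigma -> theta < 1 -> 0 < b -> 0 < x ->
  kernel_majorant sigma (b * x) ^+ 2 * gamma_pdf sigma theta x <=
  2 / Gamma sigma * (b / (1 - theta)) `^ (2^-1 - sigma) *
   expR (4 * b / (1 - theta)) *
   cauchy_powR 2^-1 (Num.sqrt (1 - theta)) (2 * Num.sqrt (b / (1 - theta))) x.
Proof.
move=> s0 th1 b0 x0; set a := 1 - theta; have a0 : 0 < a by rewrite subr_gt0.
have G0 := Gamma_gt0 s0.
have -> : gamma_pdf sigma theta x =
    a `^ sigma * (x `^ (sigma - 1) * expR (- (a * x)) / Gamma sigma).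
  rewrite /gamma_pdf indicE mem_set ?mulr1; last by rewrite /= in_itv/= andbT.
  rewrite -/a; congr (_ * (_ / _)); rewrite mulrAC -expRD mulrC; congr (_ * expR _).
  by rewrite /a; ring.
have -> : kernel_majorant sigma (b * x) ^+ 2 =
    b `^ (2^-1 - sigma) * x `^ (2^-1 - sigma) * expR (4 * Num.sqrt (b * x)).
  rewrite /kernel_majorant exprMn -(powR_mulrn 2 (powR_ge0 _ _)) -powRrM -expRM_natl.
  rewrite powRM ?(ltW b0) ?(ltW x0)//; congr (_ `^ _ * _ `^ _ * expR _); by field.
pose u := Num.sqrt a * x `^ 2^-1 - 2 * Num.sqrt (b / a).
have -> : cauchy_powR 2^-1 (Num.sqrt a) (2 * Num.sqrt (b / a)) x =
    Num.sqrt a * (2^-1 * x `^ (2^-1 - 1)) * (1 + u ^+ 2)^-1 by [].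
have eE : 4 * Num.sqrt (b * x) - a * x = 4 * b / a - u ^+ 2.
  rewrite /u powR12_sqrt ?(ltW x0)// sqrtrM ?(ltW b0)// sqrtrM ?(ltW b0)// sqrtrV ?(ltW a0)//.
  have sa : Num.sqrt a ^+ 2 = a by rewrite sqr_sqrtr ?ltW.
  have sb : Num.sqrt b ^+ 2 = b by rewrite sqr_sqrtr ?ltW.
  have sx : Num.sqrt x ^+ 2 = x by rewrite sqr_sqrtr ?ltW.
  have sa0 : Num.sqrt a != 0 by rewrite gt_eqF// sqrtr_gt0.
  rewrite -[X in _ - X * _]sa -[X in _ - _ * X]sx -[X in 4 * X / _]sb -[X in _ / X - _]sa.
  by field.
have aE : b `^ (2^-1 - sigma) * a `^ sigma = (b / a) `^ (2^-1 - sigma) * Num.sqrt a.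
  rewrite powRM ?invr_ge0 ?(ltW a0) ?(ltW b0)// -mulrA; congr (_ * _).
  rewrite -(powR_inv1 (ltW a0)) -powRrM -powR12_sqrt ?(ltW a0)// -gt0_powRD//.
  by congr (_ `^ _); ring.
have xE : x `^ (2^-1 - sigma) * x `^ (sigma - 1) = x `^ (2^-1 - 1).
  by rewrite -gt0_powRD//; congr (_ `^ _); ring.
rewrite [leLHS](_ : _ = (b `^ (2^-1 - sigma) * a `^ sigma) *
   (x `^ (2^-1 - sigma) * x `^ (sigma - 1)) / Gamma sigma *
   (expR (4 * Num.sqrt (b * x)) * expR (- (a * x)))); last by ring.
rewrite -expRD eE aE xE expRD.
rewrite [leRHS](_ : _ = (b / a) `^ (2^-1 - sigma) * Num.sqrt a * x `^ (2^-1 - 1) /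
  Gamma sigma * (expR (4 * b / a) * (1 + u ^+ 2)^-1)); last first.
  by move: ((1 + u ^+ 2)^-1) => w; field; rewrite !gt_eqF.
rewrite ler_wpM2l//.
  by rewrite !mulr_ge0 ?powR_ge0 ?sqrtr_ge0 ?invr_ge0 ?Gamma_ge0.
by rewrite ler_wpM2l ?expR_ge0// expRN_sqr_le.
Qed.

Lemma measurable_kernel_majorant (sigma : R) : measurable_fun setT (kernel_majorant sigma).
Proof.
apply: measurable_funM; first exact: measurable_powR.
apply: measurableT_comp => //; apply: measurable_funM => //.
exact: (continuous_measurable_fun (@sqrt_continuous R)).
Qed.

Lemma majorant_moment_le (sigma theta b : R) : 0 < sigma -> theta < 1 -> 0 < b ->
  (\int[mu]_x (kernel_majorant sigma (b * x) ^+ 2 * gamma_pdf sigma theta x)%:E <=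
  (2 * pi / Gamma sigma * (b / (1 - theta)) `^ (2^-1 - sigma) *
   expR (4 * b / (1 - theta)))%:E)%E.
Proof.
move=> s0 th1 b0; have a0 : 0 < 1 - theta by rewrite subr_gt0.
have G0 := Gamma_gt0 s0.
set D := 2 / Gamma sigma * (b / (1 - theta)) `^ (2^-1 - sigma) * expR (4 * b / (1 - theta)).
have D0 : 0 <= D by rewrite !mulr_ge0 ?powR_ge0 ?expR_ge0 ?invr_ge0 ?Gamma_ge0.
pose g := cauchy_powR 2^-1 (Num.sqrt (1 - theta)) (2 * Num.sqrt (b / (1 - theta))).
have mg : measurable_fun (`]0, +oo[ : set R) g.
  by apply: continuous_measurable_pos => x; exact: continuous_cauchy_powR.
apply: (@le_trans _ _ (\int[mu]_(x in `]0%R, +oo[) (D * g x)%:E)%E).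
  rewrite [leRHS]integral_mkcond; apply: ge0_le_integral => //=.
  - by move=> x _; rewrite lee_fin mulr_ge0 ?sqr_ge0 ?gamma_pdf_ge0.
  - apply/measurable_EFinP; apply: measurable_funM; last exact: measurable_gamma_pdf.
    apply: measurable_funX; apply: measurableT_comp; first exact: measurable_kernel_majorant.
    exact: measurable_funM.
  - apply/(measurable_restrictT _ _).1 => //.
    apply/measurable_EFinP; exact: measurable_funM.
  - move=> x _; rewrite patchE; case: ifPn => [|xD].
      by rewrite inE/= in_itv/= andbT => x0; rewrite lee_fin majorant_pdf_le.
    by rewrite /gamma_pdf indicE (negbTE xD) !mulr0.
under eq_integral do rewrite EFinM.
rewrite ge0_integralZl//.
- rewrite integral_cauchy_powR ?sqrtr_gt0// -EFinM lee_fin.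
  rewrite [leRHS](_ : _ = D * pi); last by rewrite /D; ring.
  rewrite ler_wpM2l//.
  have := ltW (atan_gtNpi2 (- (2 * Num.sqrt (b / (1 - theta))))); lra.
- exact/measurable_EFinP.
- by move=> x _; rewrite lee_fin cauchy_powR_ge0 ?sqrtr_ge0.
Qed.

(** With tau = t / (1 - theta) and b = max(t, 1 - theta), the pointwise bound on the
kernel and the moment of its majorant give the order tau^(1/2 - sigma) exp(4 tau)
for tau >= 1 and tau^2 for tau <= 1. *)
Lemma kernel_second_moment_le (sigma theta0 : R) (omega : R -> R) :
  0 < sigma -> admissible omega ->
  exists2 C : R, 0 < C & forall t, 0 < t -> exists c0 : R, forall theta, theta < 1 ->
    (\int[mu]_x ((K sigma theta0 omega t x - c0) ^+ 2 * gamma_pdf sigma theta x)%:E <=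
     (C * (expR (4 * t / (1 - theta)) * (t / (1 - theta)) `^ (3 / 4 - sigma)))%:E)%E.
Proof.
move=> s0 hom; have [A A0 hA] := K_dist_le s0.
have G0 := Gamma_gt0 s0.
pose D := A ^+ 2 * (2 * pi / Gamma sigma).
have D0 : 0 < D by rewrite !mulr_gt0 ?exprn_gt0 ?pi_gt0 ?invr_gt0.
exists (D * expR 4); first by rewrite mulr_gt0 ?expR_gt0.
move=> t t0; have [c0 hc] := hA theta0 omega t hom (ltW t0).
exists c0 => theta th1.
have mK := measurable_K theta0 s0 hom (ltW t0).
set a := 1 - theta; have a0 : 0 < a by rewrite subr_gt0.
(* The parameter b is a below when tau <= 1 and t when tau >= 1. *)
have bound b : 0 < b -> t <= b ->
    (\int[mu]_x ((K sigma theta0 omega t x - c0) ^+ 2 * gamma_pdf sigma theta x)%:E <=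
    ((t / b) ^+ 2 * D * ((b / a) `^ (2^-1 - sigma) * expR (4 * b / a)))%:E)%E.
  move=> b0 tb.
  apply: (@le_trans _ _ (\int[mu]_x ((((t / b) * A) ^+ 2)%:E *
      (kernel_majorant sigma (b * x) ^+ 2 * gamma_pdf sigma theta x)%:E))%E).
    apply: ge0_le_integral => //=.
    - by move=> x _; rewrite lee_fin mulr_ge0 ?sqr_ge0 ?gamma_pdf_ge0.
    - apply/measurable_EFinP; apply: measurable_funM; last exact: measurable_gamma_pdf.
      apply: measurable_funX; exact: measurable_funB.
    - apply/measurable_EFinP; apply: measurable_funM => //.
      apply: measurable_funM; last exact: measurable_gamma_pdf.
      apply: measurable_funX; apply: measurableT_comp; first exact: measurable_kernel_majorant.
      exact: measurable_funM.
    - move=> x _; rewrite -EFinM lee_fin.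
      have [x0|x0] := ltP 0 x; last first.
        rewrite /gamma_pdf indicE memNset ?mulr0 ?mulr0//.
        by rewrite /= in_itv/= andbT; apply/negP; rewrite -leNgt.
      rewrite [leRHS]mulrA ler_wpM2r ?gamma_pdf_ge0// -exprMn.
      rewrite -(real_normK (num_real (_ - c0))) lerXn2r ?nnegrE//.
        by rewrite !mulr_ge0 ?invr_ge0 ?powR_ge0 ?expR_ge0 ?ltW.
      by rewrite -[leRHS]mulrA hc.
  rewrite ge0_integralZl//; first last.
  - by rewrite lee_fin sqr_ge0.
  - by move=> x _; rewrite lee_fin mulr_ge0 ?sqr_ge0 ?gamma_pdf_ge0.
  - apply/measurable_EFinP.
    apply: measurable_funM; last exact: measurable_gamma_pdf.
    apply: measurable_funX; apply: measurableT_comp; first exact: measurable_kernel_majorant.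
    exact: measurable_funM.
  apply: (le_trans (lee_wpmul2l _ (majorant_moment_le s0 th1 b0))).
    by rewrite lee_fin sqr_ge0.
  rewrite -EFinM lee_fin le_eqVlt; apply/orP; left; apply/eqP.
  by rewrite /D -/a; ring.
have tau0 : 0 < t / a by rewrite divr_gt0.
have [ta|ta] := leP t a.
  (* Here b / a = 1, so that the exponential of the majorant is the constant exp 4. *)
  apply: (le_trans (bound a a0 ta)); rewrite lee_fin divff ?gt_eqF// powR1 mul1r mulfK ?gt_eqF//.
  rewrite [leLHS](_ : _ = D * expR 4 * (1 * (t / a) ^+ 2)); last by ring.
  rewrite ler_wpM2l ?(ltW (mulr_gt0 D0 (expR_gt0 _)))//.
  rewrite ler_pM ?sqr_ge0//.
    by rewrite -expR0 ler_expR divr_ge0 ?mulr_ge0 ?ltW.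
  rewrite -powR_mulrn ?(ltW tau0)// ger_powR ?tau0 ?ler_pdivrMr ?mul1r//; lra.
apply: (le_trans (bound t t0 (lexx t))); rewrite lee_fin divff ?gt_eqF// expr1n mul1r.
rewrite -[leRHS]mulrA ler_wpM2l ?(ltW D0)//.
rewrite -[leLHS]mul1r ler_pM ?mulr_ge0 ?powR_ge0 ?expR_ge0//.
  by rewrite -expR0 ler_expR.
rewrite mulrC ler_wpM2l ?expR_ge0// ler_powR//; last by lra.
by rewrite ler_pdivlMr// mul1r ltW.
Qed.

End second_moment.

(** * Measures with densities, independence and variance *)

(** The density agrees almost everywhere with the Radon-Nikodym derivative. *)
Lemma ge0_integral_density d (T : measurableType d) (R : realType)
    (nu : {finite_measure set T -> \bar R}) (mu : {sigma_finite_measure set T -> \bar R})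
    (f h : T -> R) :
  (forall x, 0 <= f x) -> measurable_fun setT f ->
  (forall A, measurable A -> nu A = (\int[mu]_(x in A) (f x)%:E)%E) ->
  (forall x, 0 <= h x) -> measurable_fun setT h ->
  (\int[nu]_x (h x)%:E = \int[mu]_x (h x * f x)%:E)%E.
Proof.
move=> f0 mf nuE h0 mh.
have numu : nu `<< mu.
  apply/null_content_dominatesP => A mA muA0; rewrite nuE//.
  by apply: null_set_integral => //; exact/measurable_EFinP/measurable_funTS.
have mfR := measurable_int _ (Radon_Nikodym_SigmaFinite.f_integrable numu).
rewrite -(Radon_Nikodym_SigmaFinite.change_of_variables numu)//; last first.
  exact/measurable_EFinP.
apply: ae_eq_integral => //.
- by apply: emeasurable_funM => //; exact/measurable_EFinP.
- by apply/measurable_EFinP; exact: measurable_funM.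
- under [X in ae_eq _ _ _ X]eq_fun do rewrite EFinM.
  apply: ae_eqe_mul2l.
  apply: integral_ae_eq => //.
  + exact: Radon_Nikodym_SigmaFinite.f_integrable.
  + exact/measurable_EFinP.
  + move=> E _ mE; rewrite -nuE//.
    by rewrite -Radon_Nikodym_SigmaFinite.f_integral.
Qed.

Section independence.
Context d (T : measurableType d) (R : realType) (P : probability T R).

(** The product rule on rectangles determines the joint law, which is therefore the
product of the two laws; Fubini's theorem then separates the integrals. *)
Lemma expectation_mul_indep (X Y : {RV P >-> R}) (f g : R -> R) :
  measurable_fun setT f -> measurable_fun setT g ->
  (forall A B, measurable A -> measurable B ->
    P (X @^-1` A `&` Y @^-1` B) = (P (X @^-1` A) * P (Y @^-1` B))%E) ->
  f \o X \in Lfun P 1 -> g \o Y \in Lfun P 1 ->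
  (f \o X) \* (g \o Y) \in Lfun P 1 ->
  ('E_P[(f \o X) \* (g \o Y)] = 'E_P[f \o X] * 'E_P[g \o Y])%E.
Proof.
move=> mf mg ind iX iY iXY.
have mZ : measurable_fun setT (fun w => (X w, Y w)) by exact: measurable_fun_pair.
pose Z : {mfun T >-> (R * R)%type} := mfun_Sub (mem_set mZ).
pose h (z : R * R) : \bar R := (f z.1 * g z.2)%:E.
have mh : measurable_fun setT h.
  apply/measurable_EFinP; apply: measurable_funM; exact: measurableT_comp.
have hind A : measurable A ->
    (distribution P X \x distribution P Y)%E A = distribution P Z A.
  apply: product_measure_unique => B C mB mC.
  by rewrite /= /distribution /pushforward/= -ind.
have ihZ : P.-integrable setT (h \o Z) by move/Lfun1_integrable : iXY.
have ih : (distribution P X \x distribution P Y)%E.-integrable setT h.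
  have [_ fin] := integrableP _ _ _
    (integrable_pushforward (measurable_funPT Z) mh ihZ measurableT).
  apply/integrableP; split => //.
  by rewrite (eq_measure_integral (distribution P Z))//= => A mA _; exact: hind.
have gE : (\int[distribution P Y]_y (g y)%:E = 'E_P[g \o Y])%E.
  rewrite unlock (@integral_distribution _ _ _ _ _ P Y (EFin \o g))//.
    exact/measurable_EFinP.
  exact/Lfun1_integrable.
have fE : (\int[distribution P X]_x (f x)%:E = 'E_P[f \o X])%E.
  rewrite unlock (@integral_distribution _ _ _ _ _ P X (EFin \o f))//.
    exact/measurable_EFinP.
  exact/Lfun1_integrable.
have jY : (distribution P Y).-integrable setT (EFin \o g).
  apply: (integrable_pushforward (measurable_funPT Y)) => //.
    exact/measurable_EFinP.
  exact/Lfun1_integrable.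
have jX : (distribution P X).-integrable setT (EFin \o f).
  apply: (integrable_pushforward (measurable_funPT X)) => //.
    exact/measurable_EFinP.
  exact/Lfun1_integrable.
transitivity (\int[distribution P Z]_z h z)%E.
  by rewrite unlock integral_distribution.
rewrite (eq_measure_integral (distribution P X \x distribution P Y)%E); last first.
  by move=> A mA _; exact: (esym (hind A mA)).
rewrite -integral12_prod_meas1//.
have inner x : (fubini_F (distribution P Y) h x = (f x)%:E * 'E_P[g \o Y])%E.
  rewrite /fubini_F /h /=; under eq_integral do rewrite EFinM.
  by rewrite integralZl// gE.
under eq_integral do rewrite inner.
by rewrite -fE -(fineK (expectation_fin_num iY)) integralZr.
Qed.

Lemma Lfun2_sqr (X : T -> R) : measurable_fun setT X ->
  (\int[P]_w (X w ^+ 2)%:E < +oo)%E -> X \in Lfun P 2%:E.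
Proof.
move=> mX X2; rewrite inE; apply/andP; split; rewrite inE//=.
rewrite /finite_norm unlock poweR_lty//.
by under eq_integral do rewrite /= powR_mulrn// real_normK ?num_real//.
Qed.

(** The mean minimises the mean square distance to a constant. *)
Lemma variance_le_sqr (X : T -> R) (c : R) : X \in Lfun P 2%:E ->
  ('V_P[X] <= \int[P]_w ((X w - c) ^+ 2)%:E)%E.
Proof.
move=> X2; rewrite -(varianceB_cst_r c X2).
have Xc2 : (X \- cst c)%R \in Lfun P 2%:E.
  by rewrite rpredB ?lee1n//= => _; rewrite Lfun_cst.
rewrite varianceE// [X in ('E_P[X] - _)%E](_ : _ = (fun w => (X w - c) ^+ 2))//.
rewrite {1}unlock leeBlDr; last first.
  by rewrite fin_numX// expectation_fin_num// Lfun_subset12// fin_num_measure.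
by rewrite leeDl// sqre_ge0.
Qed.

Lemma variance_sum_uncorrelated (I : eqType) (s : seq I) (X : I -> T -> R) : uniq s ->
  (forall i, X i \in Lfun P 2%:E) ->
  (forall i j, i != j -> covariance P (X i) (X j) = 0%E) ->
  ('V_P[(\sum_(i <- s) X i)%R] = \sum_(i <- s) 'V_P[X i])%E.
Proof.
move=> us X2 cov0.
have X1 i : X i \in Lfun P 1 by rewrite Lfun_subset12// fin_num_measure.
elim: s us => [|a s IH] /=; first by rewrite !big_nil variance_cst.
move=> /andP[as_ us]; rewrite !big_cons -IH//.
have S2 : \sum_(i <- s) X i \in Lfun P 2%:E by rewrite rpred_sum ?lee1n//.
have cov : covariance P (X a) (\sum_(i <- s) X i) = 0%E.
  move: as_ {IH us S2}; elim: s => [|b s IH].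
    by rewrite big_nil covariance_cst_r.
  rewrite inE negb_or => /andP[ab as_]; rewrite big_cons.
  have S2 : \sum_(i <- s) X i \in Lfun P 2%:E by rewrite rpred_sum ?lee1n//.
  by rewrite covarianceDr// cov0// IH// adde0.
by rewrite varianceD// cov mule0 adde0.
Qed.

End independence.

(** * The variance and deviation bounds *)

Lemma mutually_independent_pair (d : measure_display) (T : measurableType d)
    (R : realType) (P : probability T R) (I : finType) (X : I -> {RV P >-> R}) (i j : I) :
  mutually_independent X -> i != j ->
  forall A B, measurable A -> measurable B ->
    P (X i @^-1` A `&` X j @^-1` B) = (P (X i @^-1` A) * P (X j @^-1` B))%E.
Proof.
move=> ind ij A B mA mB.
pose D k := if k == i then A else B.
have Di : D i = A by rewrite /D eqxx.
have Dj : D j = B by rewrite /D eq_sym (negbTE ij).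
have := ind [set i; j]%SET D; rewrite big_setU1 ?inE// big_set1 Di Dj => <-.
  congr (P _); apply/seteqP; split => w /=.
    move=> [iA jB] k; rewrite /= !inE => /orP[/eqP ->|/eqP ->].
      by rewrite Di.
    by rewrite Dj.
  move=> h; split.
    by rewrite -[A]Di; apply: h; rewrite /= !inE eqxx.
  by rewrite -[B]Dj; apply: h; rewrite /= !inE eqxx orbT.
by move=> k _; rewrite /D; case: ifP.
Qed.

Lemma u3_gt0_le (R : realType) (n : nat) (theta : 'I_n.+1 -> R) (i : 'I_n.+1) :
  (forall i, theta i < 1) -> 0 < u3 theta <= 1 - theta i.
Proof.
move=> th1; apply/andP; split; last exact: bigmin_le.
by apply: lt_bigmin => [|j _]; rewrite subr_gt0.
Qed.

Theorem theorem8 (R : realType) (sigma theta0 : R) (omega : R -> R)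
    (hsigma : 0 < sigma) (htheta0 : theta0 < 1) (homega : admissible omega) :
  exists C t0 : R, 0 < C /\
    forall (n : nat) (theta : 'I_n.+1 -> R) (d : measure_display)
      (T : measurableType d) (P : probability T R)
      (z : 'I_n.+1 -> {RV P >-> R}) (t : R),
      (forall i, theta i < 1) ->
      mutually_independent z ->
      (forall i (A : set R), measurable A ->
        distribution P (z i) A = gamma_prob sigma (theta i) A) ->
      0 < t -> t0 <= t ->
      ('V_P[(fun w => phi_hat sigma theta0 omega t (fun i => z i w)
                      - phi sigma theta0 omega t theta)%R]
        <= (V_III C sigma t theta)%:E)%E /\
      (forall lambda : R, 0 < lambda ->
        (P [set w | (lambda <=
              `| phi_hat sigma theta0 omega t (fun i => z i w)
                 - phi sigma theta0 omega t theta |)%R]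
          <= (lambda ^- 2 * V_III C sigma t theta)%:E)%E).
Proof.
have [C C0 hC] := kernel_second_moment_le theta0 hsigma homega.
exists C, 0; split => // n theta d T P z t th1 ind hdist t0 _.
have [c0 hc0] := hC t t0.
pose k := K sigma theta0 omega t.
have mk : measurable_fun setT k := measurable_K theta0 hsigma homega (ltW t0).
pose tau i := t / (1 - theta i).
pose bnd i := C * (expR (4 * t / u3 theta) * tau i `^ (3 / 4 - sigma)).
have mz i : @measurable_fun _ _ T (measurableTypeR R) setT (z i).
  exact: (measurable_funPT (z i)).
(* The laws are compared with Lebesgue measure, whose sigma-algebra carries another
   display than the default one of R: zL i is z i with that codomain. *)
pose zL i : {mfun T >-> measurableTypeR R} :=
  @mfun_Sub _ _ T (measurableTypeR R) (z i) (mem_set (mz i)).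
have sqr_le i : (\int[P]_w ((k (z i w) - c0) ^+ 2)%:E <= (bnd i)%:E)%E.
  have mh : measurable_fun setT (fun x => (k x - c0) ^+ 2).
    by apply: measurable_funX; exact: measurable_funB.
  rewrite -(@ge0_integral_distribution _ _ _ (measurableTypeR R) _ P (zL i)
     (fun x => ((k x - c0) ^+ 2)%:E)); first last.
  - by move=> y; rewrite lee_fin sqr_ge0.
  - exact/measurable_EFinP.
  have nuE A : measurable A -> distribution P (zL i) A =
      (\int[@lebesgue_measure R]_(x in A) (gamma_pdf sigma (theta i) x)%:E)%E.
    exact: (hdist i A).
  rewrite (@ge0_integral_density _ (measurableTypeR R) _ (distribution P (zL i))
    (@lebesgue_measure R) (gamma_pdf sigma (theta i)) (fun x => (k x - c0) ^+ 2)
    (gamma_pdf_ge0 _ _) (measurable_gamma_pdf _ _) nuE (fun=> sqr_ge0 _) mh).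
  apply: (le_trans (hc0 _ (th1 i))); rewrite lee_fin ler_wpM2l ?(ltW C0)//.
  rewrite ler_wpM2r ?powR_ge0// ler_expR.
  have /andP[u0 ui] := u3_gt0_le i th1.
  rewrite ler_wpM2l ?mulr_ge0 ?(ltW t0)// lef_pV2 ?posrE//.
  exact: lt_le_trans ui.
have mkz i : measurable_fun setT (k \o z i) by exact: measurableT_comp.
have L2 i : k \o z i \in Lfun P 2%:E.
  have h : (fun w => k (z i w) - c0) \in Lfun P 2%:E.
    apply: Lfun2_sqr; first exact: (measurable_funB (mkz i) (measurable_cst _)).
    exact: le_lt_trans (sqr_le i) (ltry _).
  have -> : k \o z i = (fun w => k (z i w) - c0) + cst c0.
    by apply/funext => w; rewrite /= fctE subrK.
  by rewrite rpredD ?lee1n//= => _; rewrite Lfun_cst.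
have L1 i : k \o z i \in Lfun P 1 by rewrite Lfun_subset12// fin_num_measure.
pose m : R := n.+1%:R.
have m0 : 0 < m by rewrite ltr0n.
have Ek i : ('E_P[k \o z i] = (psi sigma theta0 omega t (theta i))%:E)%E.
  rewrite /psi /Rintegral (eq_measure_integral (distribution P (zL i))); last first.
    by move=> A mA _; rewrite /= -(hdist i A).
  rewrite -[LHS]fineK ?expectation_fin_num//; congr (fine _)%:E.
  rewrite unlock (@integral_distribution _ _ _ (measurableTypeR R) _ P (zL i) (EFin \o k))//.
    exact/measurable_EFinP.
  by have /Lfun1_integrable := L1 i.
pose f i x : R := m^-1 * psi sigma theta0 omega t (theta i) + k x * - m^-1.
(* X i is the contribution of z i to the estimation error, centred by [Ek]. *)
pose X i : T -> R := f i \o z i.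
have mf i : measurable_fun setT (f i).
  by apply: measurable_funD => //; exact: measurable_funM.
have XE i : X i = cst (m^-1 * psi sigma theta0 omega t (theta i)) \+ (- m^-1) \o* (k \o z i).
  by [].
have XL2 i : X i \in Lfun P 2%:E.
  rewrite XE rpredD ?lee1n//= => _; first by rewrite Lfun_cst.
  by rewrite Lfun_scale ?ler1n.
have XL1 i : X i \in Lfun P 1 by rewrite Lfun_subset12// fin_num_measure.
have EX i : ('E_P[X i] = 0)%E.
  rewrite XE expectationD ?Lfun_cst ?Lfun_scale// expectation_cst expectationZl//.
  by rewrite Ek -EFinM -EFinD mulNr subrr.
have VX i : ('V_P[X i] <= (m^-1 ^+ 2 * bnd i)%:E)%E.
  rewrite XE varianceD_cst_l ?Lfun_scale ?ler1n// varianceZ// sqrrN (EFinM _ (bnd i)).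
  rewrite lee_wpmul2l ?lee_fin ?sqr_ge0//.
  exact: le_trans (variance_le_sqr c0 (L2 i)) (sqr_le i).
have covX i j : i != j -> covariance P (X i) (X j) = 0%E.
  move=> ij; rewrite covarianceE ?Lfun2_mul_Lfun1// !EX mul0e sube0.
  have -> : (X i * X j)%R = (f i \o z i) \* (f j \o z j) by [].
  rewrite (expectation_mul_indep (mf i) (mf j)).
  - have -> : ('E_P[f i \o z i] = 0)%E by exact: EX.
    by rewrite mul0e.
  - exact: mutually_independent_pair.
  - exact: XL1.
  - exact: XL1.
  - exact: (Lfun2_mul_Lfun1 (XL2 i) (XL2 j)).
have SE : (fun w => phi_hat sigma theta0 omega t (fun i => z i w)
      - phi sigma theta0 omega t theta) = \sum_i X i.
  apply/funext => w; rewrite /phi_hat /phi -mulrBr -sumrB mulr_sumr fct_sumE.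
  by apply: eq_bigr => i _; rewrite /X /f /= /k /m; ring.
have VS : ('V_P[(\sum_i X i)%R] <= (V_III C sigma t theta)%:E)%E.
  rewrite variance_sum_uncorrelated ?index_enum_uniq//.
  apply: (le_trans (lee_sum _ (fun i _ => VX i))).
  rewrite sumEFin lee_fin /V_III -mulr_sumr le_eqVlt; apply/orP; left; apply/eqP.
  rewrite /bnd -mulr_sumr -mulr_sumr exprVn /m /tau; ring.
rewrite SE; split => // lambda l0.
have ES : ('E_P[(\sum_i X i)%R] = 0)%E.
  rewrite -(big_map X xpredT id) expectation_sum; last by move=> _ /mapP[i _ ->].
  by rewrite big_map big1.
have mS : measurable_fun setT (\sum_i X i).
  have : \sum_i X i \in Lfun P 1 by rewrite rpred_sum.
  by rewrite inE => /andP[/[!inE]].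
have := @chebyshev _ _ _ P (mfun_Sub (mem_set mS)) lambda l0.
rewrite /= ES /= => cheb.
rewrite [X in P X](_ : _ = [set w | lambda <= `|(\sum_i X i) w - 0|]); last first.
  by apply/seteqP; split => w /=; rewrite -SE subr0.
by apply: (le_trans cheb); rewrite EFinM lee_wpmul2l// lee_fin invr_ge0 sqr_ge0.
Qed.
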